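(* Let $d\ge1$, $s\ge1$, and $p\ge q\ge d+1$ be integers. Then $$\mathrm{HD}_d^{(s)}(p,q)\ge p-q+d(s-1)+1.$$ In particular, for $d\ge2$ and $s\ge2$, the bound $p-q+2$ (valid for ordinary convex sets for large $q$) does not extend to $s$-convex sets, i.e. $\mathrm{HD}_d^{(s)}(p,q)>p-q+2$.
   Context: A set in $\mathbb{R}^d$ is called $s$-convex if it is the union of at most $s$ convex sets. For positive integers $p\ge q$, a family $\mathcal F$ of (distinct) sets with at least $p$ members satisfies the $(p,q)$-property if among every $p$ members of $\mathcal F$ some $q$ have a nonempty common intersection. A transversal (piercing set) of $\mathcal F$ is a set of points meeting every member of $\mathcal F$, and $\tau(\mathcal F)$ is the minimum size of a transversal. For $p\ge q\ge d+1$, $\mathrm{HD}_d^{(s)}(p,q)$ denotes the least integer $N$ such that $\tau(\mathcal F)\le N$ for every finite family $\mathcal F$ of nonempty $s$-convex sets in $\mathbb{R}^d$ satisfying the $(p,q)$-property. *)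

(* Defs.v *)
From mathcomp Require Import all_boot all_order all_algebra finmap.
From mathcomp Require Import all_classical all_reals.
From mathcomp Require Import ereal convex.

Set Implicit Arguments.
Unset Strict Implicit.
Unset Printing Implicit Defensive.

Import Order.TTheory GRing.Theory Num.Theory.

Local Open Scope classical_set_scope.
Local Open Scope ring_scope.

(* The minimum of a set of naturals, as an extended real: it is the least
   element when the set is nonempty, and +oo when the set is empty. *)
Definition minimum (R : realType) (A : set nat) : \bar R :=
  ereal_inf [set n%:R%:E | n in A].

Lemma minimum_least (R : realType) (A : set nat) (n : nat) :
  A n -> (forall m, A m -> (n <= m)%N) -> minimum R A = n%:R%:E.
Proof.
move=> An lbn; apply/eqP; rewrite eq_le; apply/andP; split.
  by apply: ereal_inf_lbound; exists n.
by apply: le_ereal_inf_tmp => _ [m Am <-]; rewrite lee_fin ler_nat lbn.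
Qed.

Lemma minimum_set0 (R : realType) : minimum R set0 = +oo%E.
Proof. by rewrite /minimum image_set0 ereal_inf0. Qed.

Definition s_convex (R : realType) (d s : nat) (S : set 'rV[R]_d) : Prop :=
  exists C : {fset set 'rV[R]_d},
    [/\ (#|` C| <= s)%N,
        forall A, A \in C -> convex_set A &
        S = \bigcup_(A in [set` C]) A].

Definition pq_property (T : Type) (p q : nat) (F : {fset set T}) : Prop :=
  (p <= #|` F|)%N /\
  forall G : {fset set T}, (G `<=` F)%fset -> #|` G| = p ->
    exists H : {fset set T},
      [/\ (H `<=` G)%fset, #|` H| = q & \bigcap_(A in [set` H]) A !=set0].

Definition transversal (T : choiceType) (F : {fset set T}) (P : {fset T}) :
  Prop := forall A, A \in F -> A `&` [set` P] !=set0.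

Definition tau (R : realType) (T : choiceType) (F : {fset set T}) : \bar R :=
  minimum R [set #|` P| | P in transversal F].

(* HD R d s p q is $\mathrm{HD}_d^{(s)}(p,q)$, for families in R^d. *)
Definition HD (R : realType) (d s p q : nat) : \bar R :=
  minimum R [set N : nat | forall F : {fset set 'rV[R]_d},
    (forall A, A \in F -> A !=set0 /\ s_convex s A) ->
    pq_property p q F -> (tau R F <= N%:R%:E)%E].

(* Main.v *)
(* Take many points X on the moment curve, so that a hyperplane contains at
   most d of them, and put m = d * (s - 1). Any m points P of R^d are avoided by
   a union of s convex hulls of subsets of X that together miss at most m points
   of X: cut s - 1 times along hyperplanes that support what is left of P at d
   of its points. The finitely many unions of at most s such hulls that miss at
   most m points of X are therefore not pierced by m points, while any q of them
   share a point of X as soon as |X| > q * m. Adjoining p - q singletons away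
   from conv X raises the piercing number by p - q and turns the (q,q)-property
   into the (p,q)-property. Some large half-spaces containing X are thrown in
   only to guarantee that the family has p members (for s = 1 there is a single
   hull). *)
Require Import Defs.
From mathcomp Require Import all_boot all_order all_algebra finmap.
From mathcomp Require Import all_classical all_reals.
From mathcomp Require Import ereal convex.
From mathcomp Require Import zify lra.

Import Order.TTheory GRing.Theory Num.Theory.

Lemma sub_in_count (T : eqType) (a b : pred T) (s : seq T) :
  {in s, forall x, a x -> b x} -> (count a s <= count b s)%N.
Proof.
move=> ab; rewrite (@eq_in_count _ a (predI a b)); last first.
  by move=> x /ab /=; case: (a x) => // ->.
by apply: sub_count => x /andP[].
Qed.

(** * Affine functionals and supporting hyperplanes *)

Section AffineFunctionals.
Local Open Scope classical_set_scope.
Local Open Scope ring_scope.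
Variables (R : realType) (d : nat).
Implicit Types (f g : 'cV[R]_(1 + d)) (x : 'rV[R]_d) (X P : seq 'rV[R]_d).

(* A column of length 1 + d encodes an affine functional, with the constant term
   first. *)
Definition affine f x : R := (row_mx 1%:M x *m f) 0 0.

Lemma affine_conv f x y (t : R) :
  affine f (t *: x + (1 - t) *: y) = t * affine f x + (1 - t) * affine f y.
Proof.
rewrite /affine.
have -> : row_mx (1%:M : 'M[R]_1) (t *: x + (1 - t) *: y) =
    t *: row_mx 1%:M x + (1 - t) *: row_mx 1%:M y.
  by rewrite !scale_row_mx add_row_mx -scalerDl (addrC t) subrK scale1r.
by rewrite mulmxDl -!scalemxAl !mxE.
Qed.

Lemma affineD f g x : affine (f + g) x = affine f x + affine g x.
Proof. by rewrite /affine mulmxDr mxE. Qed.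

Lemma affineZ (t : R) f x : affine (t *: f) x = t * affine f x.
Proof. by rewrite /affine -scalemxAr mxE. Qed.

Lemma affineN f x : affine (- f) x = - affine f x.
Proof. by rewrite /affine mulmxN mxE. Qed.

Lemma convex_affine_lt0 f : convex_set [set x : 'rV[R]_d | affine f x < 0].
Proof.
apply/convex_setW => x y; rewrite !inE /= => fx fy t t0 t1.
rewrite inE /=; change (affine f (t%:num *: x + (1 - t%:num) *: y) < 0).
rewrite affine_conv; nra.
Qed.

Lemma exists_ker_col m n (A : 'M[R]_(m, n)) : (m < n)%N ->
  exists2 g : 'cV[R]_n, g != 0 & A *m g = 0.
Proof.
move=> mn; have : cokermx A != 0.
  rewrite -mxrank_eq0 mxrank_coker subn_eq0 -ltnNge.
  exact: leq_ltn_trans (rank_leq_row A) mn.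
move=> /eqP cA; have [j gj] : exists j, col j (cokermx A) != 0.
  apply/not_existsP => h; apply: cA; apply/matrixP => i j.
  by have /negP/negPn/eqP/colP/(_ i) := h j; rewrite !mxE.
by exists (col j (cokermx A)) => //; rewrite colE mulmxA mulmx_coker mul0mx.
Qed.

(** A sum of real squares vanishes only if every term does. This keeps [f + t *: g] nonzero when [g]
    is orthogonal to [f]. *)
Lemma tr_mul_eq0 n (f : 'cV[R]_n) : f^T *m f = 0 -> f = 0.
Proof.
move=> /matrixP/(_ 0 0); rewrite !mxE => /eqP.
rewrite psumr_eq0 => [/allP h|i _]; last by rewrite mxE -expr2 sqr_ge0.
apply/colP => i; have := h i (mem_index_enum i).
by rewrite !mxE mulf_eq0 orbb => /eqP.
Qed.

(** Orthogonality and the zeros at [Z] impose at most d homogeneous linear equations on 1 + d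
    coefficients. *)
Lemma exists_affine_ortho f (Z : seq 'rV[R]_d) : (size Z < d)%N ->
  exists g, [/\ g != 0, f^T *m g = 0 & forall z, z \in Z -> affine g z = 0].
Proof.
move=> Zd.
pose A := col_mx f^T (\matrix_(i < size Z) row_mx 1%:M (nth 0 Z i)).
have [|g g0 Ag] := exists_ker_col _ _ A; first by rewrite !add1n.
move: Ag; rewrite mul_col_mx => /eqP.
rewrite col_mx_eq0 => /andP[/eqP fg /eqP Zg].
exists g; split => // z /(nthP 0)[i iZ <-].
have /matrixP/(_ (Ordinal iZ) 0) := Zg.
rewrite mxE [RHS]mxE => <-; rewrite /affine mxE.
by apply: eq_bigr => k _; rewrite !mxE.
Qed.

Lemma exists_seq_min (T : eqType) (h : T -> R) (s : seq T) : s != [::] ->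
  exists2 x, x \in s & forall y, y \in s -> h x <= h y.
Proof.
elim: s => // x [|z s] IH _.
  by exists x; rewrite ?mem_head// => y; rewrite inE => /eqP ->.
have [//|u us hu] := IH; case: (lerP (h x) (h u)) => xu.
  exists x; rewrite ?mem_head// => y; rewrite inE => /predU1P[->//|ys].
  exact: le_trans (hu _ ys).
exists u; first by rewrite inE us orbT.
by move=> y; rewrite inE => /predU1P[->|/hu//]; exact: ltW.
Qed.

(* Adding multiples of a functional g that is orthogonal to f and vanishes at
   the zeros of f on P keeps f nonzero and produces a new zero on P. *)
Lemma exists_supporting P : exists f,
  [/\ f != 0, forall x, x \in P -> 0 <= affine f x &
    (d <= count (fun x => affine f x == 0)%R P)%N \/
    forall x, x \in P -> affine f x = 0].
Proof.
(* Induction on the number of zeros; the start is the constant functional 1. *)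
suff H j : (j <= d)%N -> exists f,
  [/\ f != 0, forall x, x \in P -> 0 <= affine f x &
    (j <= count (fun x => affine f x == 0)%R P)%N \/
    forall x, x \in P -> affine f x = 0] by exact: H.
elim: j => [_|j IH jd].
  exists (col_mx 1%:M 0); split; last by left.
    rewrite col_mx_eq0 negb_and; apply/orP; left.
    by apply/eqP => /matrixP/(_ 0 0)/eqP; rewrite !mxE oner_eq0.
  by move=> x _; rewrite /affine mul_row_col mulmx0 addr0 mulmx1 mxE ler01.
have [f [f0 fP [jf|fP0]]] := IH (ltnW jd); last by exists f; split => //; right.
have [jf'|cf] := ltnP j (count (fun x => affine f x == 0) P).
  by exists f; split => //; left.
have [|g [g0 fg gZ]] := exists_affine_ortho f [seq x <- P | affine f x == 0].
  by rewrite size_filter (leq_ltn_trans cf).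
have [gP0|] := pselect (forall x, x \in P -> affine g x = 0).
  by exists g; split => //; [move=> x /gP0 ->|right].
move=> /existsNP[p /not_implyP[pP gp0]].
wlog gp : g g0 fg gZ gp0 / affine g p < 0 => [W|].
  have /eqP := gp0; rewrite neq_lt => /orP[gp|gp]; first exact: (W g).
  apply: (W (- g)); rewrite ?oppr_eq0 ?mulmxN ?fg ?oppr0 ?affineN//.
  - by move=> z /gZ; rewrite affineN => ->; rewrite oppr0.
  - by move=> /eqP; rewrite oppr_eq0 => /eqP.
  - by rewrite oppr_lt0.
(* The least ratio is the largest [t] for which [f + t *: g] stays nonnegative on [P]; the new zero
   appears at the minimiser [x]. *)
have [|x] := exists_seq_min _ (fun x => affine f x / - affine g x)
    [seq x <- P | affine g x < 0].
  by rewrite -has_filter; apply/hasP; exists p.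
rewrite mem_filter => /andP[gx xP] xmin.
pose t := affine f x / - affine g x.
have t0 : 0 <= t by rewrite divr_ge0 ?fP// oppr_ge0 ltW.
exists (f + t *: g); split.
- apply: contraNneq f0 => fg0; apply/eqP/tr_mul_eq0.
  have := congr1 (mulmx f^T) fg0.
  by rewrite mulmxDr -scalemxAr fg scaler0 addr0 mulmx0.
- move=> y yP; rewrite affineD affineZ.
  case: (ltrP (affine g y) 0) => gy; last by rewrite addr_ge0 ?fP// mulr_ge0.
  have := xmin y; rewrite mem_filter gy yP => /(_ isT).
  by rewrite ler_pdivlMr ?oppr_gt0// mulrN -/t lerNl -subr_ge0 opprK addrC.
- left.
  have fx0 : affine f x != 0.
    apply/negP => fx; have := gZ x; rewrite mem_filter fx xP => /(_ isT) gx0.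
    by rewrite gx0 ltxx in gx.
  (* The old zeros and [x] are disjoint, because [g] vanishes at the former and is negative at
     [x]. *)
  have := count_predUI (fun x => affine f x == 0) (pred1 x) P.
  rewrite (@eq_count _ (predI _ _) pred0); last first.
    by move=> y /=; apply/andP => -[fy /eqP yx]; rewrite yx (negbTE fx0) in fy.
  rewrite count_pred0 addn0 => cU.
  apply: (@leq_trans
    (count (predU (fun x => affine f x == 0)%R (pred1 x)) P)).
    by rewrite cU -addn1 leq_add// -has_count has_pred1.
  apply: sub_in_count => y yP /=; rewrite affineD affineZ => /orP[fy|/eqP ->].
    by rewrite (gZ y) ?mulr0 ?addr0// mem_filter fy.
  by rewrite /t invrN mulrN mulNr divfK ?subrr// lt_eqF.
Qed.

(** * Convex hulls that avoid given points *)

Definition hull (A : {fset 'rV[R]_d}) : set 'rV[R]_d :=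
  \bigcap_(B in [set B : set 'rV[R]_d | convex_set B /\ [set` A] `<=` B]) B.

Lemma convex_hull A : convex_set (hull A).
Proof.
move=> x y t /set_mem xA /set_mem yA; apply/mem_set => B BA.
by apply/set_mem/BA.1; apply/mem_set; [apply: xA|apply: yA].
Qed.

Lemma sub_hull (A : {fset 'rV[R]_d}) : [set` A] `<=` hull A.
Proof. by move=> x xA B [_]; apply. Qed.

Lemma hull_min (A : {fset 'rV[R]_d}) (B : set 'rV[R]_d) :
  convex_set B -> [set` A] `<=` B -> hull A `<=` B.
Proof. by move=> cB AB x; apply. Qed.

Lemma hull_affine_lt0 f (A : {fset 'rV[R]_d}) :
  (forall x, x \in A -> affine f x < 0) -> forall x, hull A x -> affine f x < 0.
Proof. by move=> Af; apply: hull_min => //; exact: convex_affine_lt0. Qed.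

Definition in_general_position X :=
  forall f, f != 0 -> (count (fun x => affine f x == 0)%R X <= d)%N.

(* Cutting along a supporting hyperplane through at least d points of P leaves
   one open side free of P, and the other with at most |P| - d points of P;
   the hyperplane itself loses at most d points of X. *)
Lemma exists_avoiding_hulls k X P :
  in_general_position X -> (size P <= d * k)%N ->
  exists C : seq {fset 'rV[R]_d},
    [/\ (size C <= k.+1)%N,
        forall A, A \in C -> {subset A <= X},
        (count (fun x => ~~ has (fun A : {fset _} => x \in A) C) X <= d * k)%N &
        forall A x, A \in C -> x \in P -> ~ hull A x].
Proof.
elim: k X P => [|k IH] X P gX sP.
  exists [:: [fset x in X]%fset]; split => //.
  - by move=> A; rewrite inE => /eqP -> x; rewrite inE.
  - rewrite (@eq_in_count _ _ pred0) ?count_pred0// => x xX /=.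
    by rewrite inE xX.
  - by move: sP; rewrite muln0 leqn0 => /nilP ->.
have [f [f0 fP fd]] := exists_supporting P.
(* Either d points of [P] lie on the hyperplane, or all of them do and none is strictly positive. *)
have cP : (size [seq x <- P | (affine f x > 0)%R] <= d * k)%N.
  rewrite size_filter.
  have cC := count_predC (fun x => affine f x == 0) P.
  have <- : count (predC (fun x => affine f x == 0)) P =
      count (fun x => 0 < affine f x) P.
    by apply: eq_in_count => x /fP fx /=; rewrite lt0r fx andbT.
  case: fd => [fd|fd]; first by lia.
  rewrite (@eq_in_count _ _ pred0) ?count_pred0// => x /fd /= ->.
  by rewrite eqxx.
have [|C [sC CX cC CP]] := IH [seq x <- X | (affine f x > 0)%R] _ _ cP.
  move=> g g0; rewrite count_filter (leq_trans _ (gX _ g0))//.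
  by apply: sub_count => x /andP[].
(* The new hull lies on the negative side, which is free of [P]; the hulls in [C] lie on the
   positive side and avoid the points of [P] there. *)
exists ([fset x in X | (affine f x < 0)%R]%fset :: C); split => //.
- move=> A; rewrite inE => /predU1P[->|/CX AX] x.
    by rewrite !inE => /andP[].
  by move=> /AX; rewrite mem_filter => /andP[].
(* A missed point lies on the hyperplane (at most d of these) or on the positive side, missed by
   [C]. *)
- rewrite mulnS; apply: leq_trans (leq_add (gX _ f0) cC).
  rewrite count_filter -count_predUI (leq_trans _ (leq_addr _ _))//.
  apply: sub_in_count => x xX /=; rewrite negb_or => /andP[].
  rewrite !inE xX /= -leNgt le_eqVlt eq_sym => /orP[->//|fx] ->.
  by rewrite fx orbT.
- move=> A x; rewrite inE => /predU1P[->|AC] xP Ax.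
    have : affine f x < 0.
      by apply: hull_affine_lt0 Ax => y; rewrite !inE => /andP[].
    by rewrite ltNge fP.
  have : affine (- f) x < 0.
    apply: hull_affine_lt0 Ax => y /(CX _ AC).
    rewrite mem_filter affineN => /andP[fy _].
    by rewrite oppr_lt0.
  rewrite affineN oppr_lt0 => fx; apply: (CP A x) => //.
  by rewrite mem_filter fx.
Qed.

(** * The moment curve and nested half-spaces *)

Definition moment_curve (t : R) : 'rV[R]_d := \row_(i < d) t ^+ i.+1.

Lemma affine_moment_curve f t : affine f (moment_curve t) = (rVpoly f^T).[t].
Proof.
rewrite /affine mxE horner_poly; apply: eq_bigr => i _.
rewrite insubT /= => [|i_lt]; first exact: (ltn_ord i).
rewrite mulrC [f^T _ _]mxE (_ : Sub _ _ = i); last exact: val_inj.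
congr (_ * _); rewrite mxE.
case: splitP => j ij; rewrite mxE ij; last by rewrite add1n.
by rewrite !ord1 eqxx.
Qed.

(** On the curve, [f] becomes a nonzero polynomial of degree at most d in the parameter, so it has
    at most d roots. *)
Lemma moment_curve_general_position n :
  in_general_position [seq moment_curve (i%:R) | i <- iota 0 n].
Proof.
move=> f f0; rewrite count_map.
have p0 : rVpoly f^T != 0.
  apply: contraNneq f0 => p0.
  by rewrite -[f]trmxK -[f^T]rVpolyK p0 linear0 trmx0.
rewrite (@eq_count _ _
  (preim (fun i : nat => i%:R : R) (root (rVpoly f^T)))); last first.
  by move=> i /=; rewrite affine_moment_curve.
rewrite -count_map -size_filter -ltnS.
apply: (@leq_trans (size (rVpoly f^T))); last exact: size_poly.
apply: max_poly_roots => //; first exact: filter_all.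
rewrite filter_uniq// map_inj_uniq ?iota_uniq//.
exact: mulrIn (oner_neq0 _).
Qed.

(** Parallel open half-spaces, with [c i] on the boundary of [h i]. The points [c i] tell the sets
    [h j] apart and all lie outside [h 0], which contains [X]. *)
Lemma exists_nested_convex X : (0 < d)%N ->
  exists (h : nat -> set 'rV[R]_d) (c : nat -> 'rV[R]_d),
    [/\ forall j, convex_set (h j), forall j x, x \in X -> h j x &
        forall i j, h j (c i) <-> (i < j)%N].
Proof.
move=> d0; pose i0 : 'I_d := Ordinal d0.
(* [b] exceeds the [i0]-th coordinate of every point of [X]. *)
pose b : R := 1 + \sum_(x <- X) `|x 0 i0|.
pose f j : 'cV[R]_(1 + d) := col_mx (- (b + j%:R))%:M (delta_mx i0 0).
have fE j x : affine (f j) x = x 0 i0 - (b + j%:R).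
  by rewrite /affine mul_row_col mul1mx -colE !mxE eqxx addrC mulr1n.
exists (fun j => [set x | affine (f j) x < 0]), (fun i => const_mx (b + i%:R)).
split=> [j|j x xX /=|i j /=]; first exact: convex_affine_lt0.
- rewrite fE subr_lt0 (@lt_le_trans _ _ b) ?lerDl ?ler0n//.
  rewrite /b (big_rem x)//= addrCA (le_lt_trans (ler_norm _))// ltrDl.
  by rewrite (lt_le_trans ltr01)// lerDl sumr_ge0.
- by rewrite fE mxE subr_lt0 ltrD2l ltr_nat.
Qed.
End AffineFunctionals.

Arguments affine {R d} f x.
Arguments hull {R d} A.
Arguments in_general_position {R d} X.

(** * Families of sets and their transversals *)

Section Families.
Local Open Scope classical_set_scope.
Local Open Scope nat_scope.

(** Union bound: together the members of [L] miss at most [size L * m] points of [X]. *)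
Lemma exists_common_point (T : choiceType) (X : seq T) m (L : seq (set T)) :
  (forall A, A \in L -> count (fun x => x \notin A) X <= m) ->
  size L * m < size X -> exists2 x, x \in X & forall A, A \in L -> A x.
Proof.
move=> Lm LX.
suff cL : count (fun x => ~~ all (fun A : set T => x \in A) L) X <= size L * m.
  have : has (fun x => all (fun A : set T => x \in A) L) X.
    rewrite has_count -(ltn_add2r (size L * m)) add0n (leq_trans LX)//.
    rewrite -(count_predC (fun x => all (fun A : set T => x \in A) L) X).
    by rewrite leq_add2l.
  by move=> /hasP[x xX /allP xL]; exists x => // A /xL /set_mem.
elim: L Lm {LX} => [|A L IH] Lm; first by rewrite /= count_pred0.
rewrite /= mulSn.
apply: leq_trans (leq_add (Lm A (mem_head _ _)) (IH _)); last first.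
  by move=> B BL; apply: Lm; rewrite inE BL orbT.
rewrite -count_predUI (leq_trans _ (leq_addr _ _))//.
by apply: sub_count => x /=; rewrite negb_and.
Qed.

Lemma exists_fsubset_card (K : choiceType) (A : {fset K}) n :
  n <= #|` A| -> exists2 B : {fset K}, (B `<=` A)%fset & #|` B| = n.
Proof.
move=> nA; exists [fset x in take n A]%fset.
  by apply/fsubsetP => x; rewrite inE => /mem_take.
by rewrite card_fseq undup_id ?take_uniq ?fset_uniq// size_takel.
Qed.

(** Among p members at most p - q are singletons from [Y]; any q of the others share a point of
    [X]. *)
Lemma pq_property_adjoin_singletons (T : choiceType) (X : seq T) m p q
    (G : {fset set T}) (Y : {fset T}) :
  (forall A, A \in G -> count (fun x => x \notin A) X <= m) ->
  q * m < size X -> p <= #|` G| -> q <= p -> #|` Y| <= p - q ->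
  pq_property p q (G `|` [fset [set y] | y in Y])%fset.
Proof.
move=> Gm qX pG qp Yp; split=> [|K KF Kp].
  by rewrite (leq_trans pG)// fsubset_leq_card// fsubsetUl.
pose Ys : {fset set T} := [fset [set y] | y in Y]%fset.
have YsY : #|` Ys| <= #|` Y| by exact: leq_imfset_card.
have [|H HK Hq] := @exists_fsubset_card _ (K `\` Ys)%fset q.
  rewrite cardfsD Kp; have := fsubset_leq_card (fsubsetIr K Ys); lia.
exists H; split => //; first exact: fsubset_trans HK (fsubsetDl _ _).
have [||x _ xH] := @exists_common_point _ X m (enum_fset H); last first.
- by exists x => A AH; exact: xH.
- by rewrite -/(#|` H|) Hq.
- move=> A /(fsubsetP HK); rewrite inE => /andP[AY /(fsubsetP KF)].
  by rewrite inE (negbTE AY) orbF; exact: Gm.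
Qed.

(** [HD] and [tau] are infima, so it suffices to bound each element of the underlying sets; an empty
    set gives +oo, which obeys the bound too. *)
Lemma HD_ge (R : realType) d s p q N (F : {fset set 'rV[R]_d}) :
  (forall A, A \in F -> A !=set0 /\ s_convex s A) -> pq_property p q F ->
  (forall P, Defs.transversal F P -> N <= #|` P|) ->
  (N%:R%:E <= HD R d s p q)%E.
Proof.
move=> Fs Fpq FN; apply: le_ereal_inf_tmp => _ [n nHD <-].
apply: le_trans (nHD F Fs Fpq); apply: le_ereal_inf_tmp => _ [_ [P FP <-] <-].
by rewrite lee_fin ler_nat FN.
Qed.

Lemma HD_lower_bound (R : realType) (d s p q : nat) :
  1 <= d -> 1 <= s -> 1 <= q -> q <= p ->
  ((p - q + d * (s - 1) + 1)%N%:R%:E <= HD R d s p q)%E.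
Proof.
move=> d1 s1 q1 qp.
pose m := d * (s - 1).
have [n qn] : exists n, q * m < n by exists (q * m).+1.
have [X [gX sX]] : exists X : seq 'rV[R]_d,
    in_general_position X /\ size X = n.
  exists [seq moment_curve R d i%:R | i <- iota 0 n]; split.
    exact: moment_curve_general_position.
  by rewrite size_map size_iota.
pose XS := [fset x in X]%fset.
have XSE x : (x \in XS) = (x \in X) by rewrite /XS inE.
pose union (C : {fset {fset 'rV[R]_d}}) : set 'rV[R]_d :=
  \bigcup_(A in [set` C]) hull A.
pose good (C : {fset {fset 'rV[R]_d}}) := (#|` C| <= s) &&
  (count (fun x => ~~ has (fun A : {fset _} => x \in A) C) X <= m).
pose G0 : {fset set 'rV[R]_d} :=
  [fset union C | C in [fset C in fpowerset (fpowerset XS) | good C]]%fset.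
have G0P S : reflect (exists C : {fset {fset 'rV[R]_d}},
    [/\ forall A, A \in C -> {subset A <= X}, good C & S = union C]) (S \in G0).
  apply: (iffP idP) => [/imfsetP[C /=]|[C [CX gC ->]]].
    rewrite !inE fpowersetE => /andP[/fsubsetP CX gC] ->.
    exists C; split => // A /CX; rewrite fpowersetE => /fsubsetP AX x /AX.
    by rewrite XSE.
  apply/imfsetP; exists C => //=; rewrite !inE fpowersetE gC andbT.
  apply/fsubsetP => A /CX AX; rewrite fpowersetE; apply/fsubsetP => x /AX.
  by rewrite XSE.
have [h [c [ch Xh cH]]] := exists_nested_convex R d X d1.
pose G1 : {fset set 'rV[R]_d} := [fset h j | j in iota 0 p]%fset.
have cardG1 : #|` G1| = p.
  rewrite card_in_imfset.
    by rewrite /= -[RHS](size_iota 0) undup_id ?iota_uniq.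
  move=> i j _ _ ij; have [/cH|/cH|//] := ltngtP i j.
    by rewrite -ij => /cH; rewrite ltnn.
  by rewrite ij => /cH; rewrite ltnn.
pose Y : {fset 'rV[R]_d} := [fset c j | j in iota 0 (p - q)]%fset.
have cardY : #|` Y| = p - q.
  rewrite card_imfset.
    by rewrite /= -[RHS](size_iota 0) undup_id ?iota_uniq.
  move=> i j ij; have [/cH|/cH|//] := ltngtP i j.
    by rewrite ij => /cH; rewrite ltnn.
  by rewrite -ij => /cH; rewrite ltnn.
have missG A : A \in (G0 `|` G1)%fset -> count (fun x => x \notin A) X <= m.
  rewrite inE => /orP[/G0P[C [_ /andP[_ Cm] ->]]|/imfsetP[j _ ->]].
    apply: leq_trans Cm; apply: sub_count => x.
    apply: contraNN => /hasP[B BC xB].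
    by apply/mem_set; exists B => //; exact: sub_hull.
  rewrite (@eq_in_count _ _ pred0) ?count_pred0// => x /(Xh j) xj.
  by rewrite /= mem_set.
apply: (@HD_ge _ _ _ _ _ _ (G0 `|` G1 `|` [fset [set y] | y in Y])%fset).
- move=> A; rewrite inE => /orP[AG|/imfsetP[y _ ->]]; last first.
    split; first by exists y.
    exists [fset [set y]]%fset; split.
    + by rewrite cardfs1.
    + move=> B; rewrite inE => /eqP -> u v t /set_mem -> /set_mem ->.
      by rewrite convmm; exact/mem_set.
    + by rewrite set_fset1 bigcup_set1.
  split.
    (* Nonemptiness is the one-set case of the union bound, as m <= q * m < |X|. *)
    have [||x _ /(_ A) xA] := @exists_common_point _ X m [:: A].
    + by move=> B; rewrite inE => /eqP ->; exact: missG.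
    + by rewrite sX (leq_ltn_trans _ qn)// leq_mul2r q1 orbT.
    + by exists x; apply: xA; rewrite inE.
  move: AG; rewrite inE => /orP[/G0P[C [_ /andP[Cs _] ->]]|/imfsetP[j _ ->]].
    exists [fset hull B | B in C]%fset; split.
    + by apply: leq_trans _ Cs; exact: leq_imfset_card.
    + by move=> B /imfsetP[D _ ->]; exact: convex_hull.
    + apply/seteqP; split => x [B BC xB].
        by exists (hull B) => //=; apply/imfsetP; exists B.
      by move: BC => /= /imfsetP[D DC BD]; exists D => //; rewrite -BD.
  exists [fset h j]%fset; split.
  + by rewrite cardfs1.
  + by move=> B; rewrite inE => /eqP ->; exact: ch.
  + by rewrite set_fset1 bigcup_set1.
- apply: (@pq_property_adjoin_singletons _ X m) => //.
  + by rewrite sX.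
  + by rewrite -[X in X <= _]cardG1 fsubset_leq_card// fsubsetUr.
  + by rewrite cardY.
move=> P trP; rewrite addn1 ltnNge; apply/negP => cP.
(* The singletons force [Y] into [P], which leaves at most m points of [P] for piercing the other
   members. *)
have YP : (Y `<=` P)%fset.
  apply/fsubsetP => y yY; have [|z [/= -> //]] := trP [set y].
  by rewrite inE; apply/orP; right; apply/imfsetP; exists y.
have [|C [Cs CX Cm CP]] :=
    @exists_avoiding_hulls R d (s - 1) X (enum_fset (P `\` Y)%fset) gX.
  by rewrite -/(#|` (P `\` Y)%fset|) cardfsDS// cardY leq_subLR.
have [|x [[A /= AC Ax] xP]] := trP (union [fset A in C]%fset).
  rewrite !inE; apply/orP; left; apply/orP; left; apply/G0P.
  exists [fset A in C]%fset; split => //.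
  + by move=> A; rewrite inE; exact: CX.
  + apply/andP; split.
      rewrite card_fseq (leq_trans (size_undup _))//.
      by rewrite (leq_trans Cs)// subn1 prednK.
    apply: leq_trans Cm; apply: sub_count => x.
    apply: contraNN => /hasP[A AC xA].
    by apply/hasP; exists A => //; rewrite inE.
rewrite inE in AC.
(* The point [x] of [P] cannot be in [Y]: it lies in a hull of points of [X], hence in [h 0], which
   contains no [c j]. *)
apply: (CP A x) => //; rewrite inE xP andbT.
apply/negP => /imfsetP[j _ xj]; have : h 0 x.
  by apply: hull_min Ax; [exact: ch|move=> y /(CX _ AC); exact: Xh].
by rewrite xj => /cH.
Qed.
End Families.

Theorem theorem1p10 (R : realType) (d s p q : nat) :
  (1 <= d)%N -> (1 <= s)%N -> (d + 1 <= q)%N -> (q <= p)%N ->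
  ((p - q + d * (s - 1) + 1)%N%:R%:E <= HD R d s p q)%E /\
  ((2 <= d)%N -> (2 <= s)%N -> ((p - q + 2)%N%:R%:E < HD R d s p q)%E).
Proof.
move=> d1 s1 dq qp.
have q1 : (1 <= q)%N by lia.
have main := HD_lower_bound R _ _ _ _ d1 s1 q1 qp.
split => // d2 s2; apply: lt_le_trans main.
(* Here d * (s - 1) >= 2, so the bound is at least p - q + 3. *)
rewrite lte_fin ltr_nat; nia.
Qed.
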